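(* Let $q\ge 1$, $N,T\in\mathbb{N}$ with $N,T\geq 1$, $\beta\in(0,1)$, and let $\Delta\in(\beta,1)$ be a desired false alarm rate. Let $\mathbb{P}_{\boldsymbol r}$ be any zero-mean $q$-light-tailed probability distribution on $\mathbb{R}^p$ (the distribution of the residue when there is no attack). Let $\epsilon(\cdot,\cdot)$ be the radius function associated with $\mathbb{P}_{\boldsymbol r}$ (defined in the context), and set $$\epsilon_{\mathrm B}:=\epsilon(N,\beta),\qquad \epsilon_{\mathrm D}:=\epsilon\!\left(T,\tfrac{\Delta-\beta}{1-\beta}\right),\qquad \alpha:=\epsilon_{\mathrm B}+\epsilon_{\mathrm D}.$$ Let $\boldsymbol r^{(1)},\dots,\boldsymbol r^{(N)}$ be i.i.d. samples of $\mathbb{P}_{\boldsymbol r}$, and, for a time $t\ge T$, let $\boldsymbol r(t),\boldsymbol r(t-1),\dots,\boldsymbol r(t-T+1)$ be i.i.d. samples of $\mathbb{P}_{\boldsymbol r}$ (residues collected with no attack), independent of $\boldsymbol r^{(1)},\dots,\boldsymbol r^{(N)}$. Let $$\mathbb{P}_{\boldsymbol r,\mathrm B}:=\frac1N\sum_{i=1}^N\delta_{\boldsymbol r^{(i)}},\qquad \mathbb{P}_{\boldsymbol r,\mathrm D}:=\frac1T\sum_{j=0}^{T-1}\delta_{\boldsymbol r(t-j)},\qquad z(t):=d_{W,q}(\mathbb{P}_{\boldsymbol r,\mathrm B},\mathbb{P}_{\boldsymbol r,\mathrm D}).$$ Then $$\mathrm{Prob}\big(z(t)\le\alpha\big)\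 \ge\ 1-\Delta .$$
   Context: $\|\cdot\|$ is a norm on $\mathbb{R}^p$ and $\delta_x$ is the unit point mass at $x$. A probability distribution $\mathbb{P}$ is $q$-light-tailed if there are $a>q$ and $b>0$ with $c:=\mathbb{E}_{\mathbb{P}}[\exp(b\|\boldsymbol w\|^a)]<\infty$, where $\boldsymbol w\sim\mathbb{P}$. For two $q$-light-tailed distributions $\mathbb{Q}_1,\mathbb{Q}_2$ on $\mathcal Z\subset\mathbb{R}^p$, the $q$-Wasserstein metric is $$d_{W,q}(\mathbb{Q}_1,\mathbb{Q}_2):=\Big(\min_{\Pi}\int_{\mathcal Z\times\mathcal Z}\|\xi_1-\xi_2\|^q\,\Pi(d\xi_1,d\xi_2)\Big)^{1/q},$$ the minimum being over all probability distributions $\Pi$ on $\mathcal Z\times\mathcal Z$ with marginals $\mathbb{Q}_1$ and $\mathbb{Q}_2$. Radius function. For a $q$-light-tailed distribution $\mathbb{P}_{\boldsymbol r}$ on $\mathbb{R}^p$, with exponent $a>q$ as in the definition of light-tailedness and constants $c_1,c_2>0$ (depending on $q$, the dimension, and $\mathbb{P}_{\boldsymbol r}$ through $a,b,c$), define for an integer $M\ge1$ and $\eta\in(0,1)$ $$\epsilon(M,\eta):=\begin{cases}\left(\dfrac{\log(c_1\eta^{-1})}{c_2M}\right)^{q/a}, & M<\dfrac{\log(c_1\eta^{-1})}{c_2},\\[2ex] \bar\epsilon, & M\ge\dfrac{\log(c_1\eta^{-1})}{c_2},\end{cases}$$ where $\bar\epsilon$ is determined by $$\frac{\bar\epsilon}{\log(2+1/\bar\epsilon)}=\left(\frac{\log(c_1\eta^{-1})}{c_2M}\right)^{1/2}\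 \text{if } p=2q,\qquad \bar\epsilon=\left(\frac{\log(c_1\eta^{-1})}{c_2M}\right)^{1/\max\{2,p/q\}}\ \text{if } p\neq 2q.$$ The constants $a,c_1,c_2$ are those of the measure-concentration theorem that the paper recalls from the literature (Fournier–Guillin) and takes as given, i.e. they are such that for every integer $M\ge1$ and every $\eta\in(0,1)$, the empirical distribution $\hat{\mathbb{P}}_M$ of $M$ i.i.d. samples of $\mathbb{P}_{\boldsymbol r}$ satisfies $$\mathrm{Prob}\big(d_{W,q}(\hat{\mathbb{P}}_M,\mathbb{P}_{\boldsymbol r})\le\epsilon(M,\eta)\big)\ge 1-\eta .$$ *)

(* Defs.v *)
From HB Require Import structures.
From mathcomp Require Import all_boot all_order all_algebra.
From mathcomp Require Import all_classical all_reals all_analysis.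
Import Order.TTheory GRing.Theory Num.Theory.
Import numFieldNormedType.Exports.

Set Implicit Arguments.
Unset Strict Implicit.
Unset Printing Implicit Defensive.

Local Open Scope classical_set_scope.
Local Open Scope ring_scope.

Record is_norm (R : realType) (V : lmodType R) (nrm : V -> R) : Prop := IsNorm {
  norm_triangle : forall x y, nrm (x + y) <= nrm x + nrm y ;
  norm_scale : forall (k : R) x, nrm (k *: x) = `|k| * nrm x ;
  norm_definite : forall x, nrm x = 0 -> x = 0 }.

(* R^p with its Borel sigma-algebra. *)
Definition borel_vec (R : realType) (p : nat) :=
  g_sigma_algebraType (@open 'rV[R]_p).
HB.instance Definition _ (R : realType) (p : nat) :=
  Measurable.on (borel_vec R p).

(* The carrier is convertible to ['rV[R]_p]. *)
Definition vec_of (R : realType) (p : nat) (x : borel_vec R p) : 'rV[R]_p := x.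

Section Empirical.
Context {d : measure_display} {T : measurableType d} {R : realType}.
Variables (n : nat) (x : 'I_n -> T).
Local Open Scope ereal_scope.

Definition empirical (A : set T) : \bar R :=
  (n%:R^-1)%:E * \sum_(i < n) \d_(x i) A.

Let empirical0 : empirical set0 = 0.
Proof. by rewrite /empirical big1 ?mule0// => i _; rewrite measure0. Qed.

Let empirical_ge0 A : 0 <= empirical A.
Proof.
by apply: mule_ge0; [rewrite lee_fin invr_ge0 ler0n|exact: sume_ge0].
Qed.

Let empirical_sigma_additive : semi_sigma_additive empirical.
Proof.
pose D (k : nat) : {measure set T -> \bar R} :=
  if insub k is Some i then (\d_(x i) : {measure set T -> \bar R}) else mzero.
have n0 : (0 <= n%:R^-1 :> R)%R by rewrite invr_ge0 ler0n.
suff -> : empirical = mscale (NngNum n0) (msum D n).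
  exact: measure_semi_sigma_additive.
apply/funext => A; rewrite /empirical /mscale /msum /=; congr (_ * _).
by apply: eq_bigr => i _; rewrite /D valK.
Qed.

HB.instance Definition _ := isMeasure.Build _ _ _ empirical
  empirical0 empirical_ge0 empirical_sigma_additive.

End Empirical.

Section Residue.
Context {R : realType} {p : nat}.
Local Notation V := (borel_vec R p).
Implicit Types (nrm : 'rV[R]_p -> R) (Pr : probability V R).

Definition light_tailed_with nrm (q : R) Pr (a b : R) : Prop :=
  [/\ q < a, 0 < b &
      ('E_Pr [fun w : V => expR (b * nrm (vec_of w) `^ a)] < +oo)%E].

Definition zero_mean Pr : Prop :=
  forall i : 'I_p, ('E_Pr [fun w : V => vec_of w ord0 i] = 0)%E.

Definition couplings (mu nu : {measure set V -> \bar R})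
    : set (probability (V * V)%type R) :=
  [set Pi : probability (V * V)%type R | forall A : set V, measurable A ->
     Pi (A `*` setT) = mu A /\ Pi (setT `*` A) = nu A].

(* The minimum over couplings is written as an infimum in the extended reals;
   for marginals with finite q-th moment it is attained. *)
Definition wasserstein nrm (q : R) (mu nu : {measure set V -> \bar R})
    : \bar R :=
  (ereal_inf
     [set (\int[Pi]_z (nrm (vec_of z.1 - vec_of z.2) `^ q)%:E)%E
     | Pi in couplings mu nu] `^ q^-1)%E.

Section Samples.
Context {d : measure_display} {Omega : measurableType d}.
Variable P : probability Omega R.

Definition mutually_independent (n : nat) (X : 'I_n -> {RV P >-> V}) : Prop :=
  forall (J : {set 'I_n}) (A : 'I_n -> set V),
    (forall i, measurable (A i)) ->
    P (\bigcap_(i in [set` J]) (X i @^-1` A i)) =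
    (\prod_(i in J) P (X i @^-1` A i))%E.

Definition iid_samples Pr (n : nat) (X : 'I_n -> {RV P >-> V}) : Prop :=
  (forall i (A : set V), measurable A -> distribution P (X i) A = Pr A) /\
  mutually_independent X.

Definition independent_families (n m : nat) (X : 'I_n -> {RV P >-> V})
    (Y : 'I_m -> {RV P >-> V}) : Prop :=
  forall E F : set Omega,
    g_sigma_preimage (fun i => X i : Omega -> V) E ->
    g_sigma_preimage (fun j => Y j : Omega -> V) F ->
    P (E `&` F) = (P E * P F)%E.

End Samples.

(* The implicit equation has exactly one positive solution when its right-hand
   side is positive, so [xget] picks that solution.  When c1 < eta the base s is
   negative and the real power has no meaning; [powR] is then a default value. *)
Definition conc_radius_bar (q c1 c2 : R) (M : nat) (eta : R) : R :=
  let s := ln (c1 * eta^-1) / (c2 * M%:R) in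
  if p%:R == 2 * q
  then xget 0 [set e : R | 0 < e /\ e / ln (2 + 1 / e) = s `^ (1 / 2)]
  else s `^ (1 / Num.max 2 (p%:R / q)).

Definition conc_radius (q a c1 c2 : R) (M : nat) (eta : R) : R :=
  if M%:R < ln (c1 * eta^-1) / c2
  then (ln (c1 * eta^-1) / (c2 * M%:R)) `^ (q / a)
  else conc_radius_bar q c1 c2 M eta.

Definition concentration nrm (q : R) Pr (eps : nat -> R -> R) : Prop :=
  forall (M : nat) (eta : R), (1 <= M)%N -> 0 < eta -> eta < 1 ->
  forall (d : measure_display) (Omega : measurableType d)
    (P : probability Omega R) (X : 'I_M -> {RV P >-> V}),
    iid_samples Pr X ->
    ((1 - eta)%:E <=
     P [set w | wasserstein nrm q (empirical (fun i => X i w)) Pr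
                <= (eps M eta)%:E])%E.

End Residue.

Arguments conc_radius_bar {R} p q c1 c2 M eta.
Arguments conc_radius {R} p q a c1 c2 M eta.

(* Main.v *)
Require Import Defs.
From HB Require Import structures.
From mathcomp Require Import all_boot all_order all_algebra.
From mathcomp Require Import all_classical all_reals all_analysis.
From mathcomp Require Import measurable_realfun ring lra.
Import Order.TTheory GRing.Theory Num.Theory.
Import numFieldNormedType.Exports.

Local Open Scope classical_set_scope.
Local Open Scope ring_scope.

(** Let E be the event that the benchmark empirical law is within eps_B of the
    residue law, and F the event that the detection empirical law is within
    eps_D of it.  Concentration gives E probability at least 1 - beta and F
    probability at least 1 - eta with eta = (Delta - beta) / (1 - beta); since
    the two samples are independent, E and F hold together with probability at
    least (1 - beta) (1 - eta) = 1 - Delta, and on their intersection the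
    triangle inequality bounds the distance of the two empirical laws by alpha.

    The two steps with content are the triangle inequality and measurability.

    A coupling of an empirical law (1/n) sum_i delta_(x i) with mu is the same
    thing as n probability laws kappa i, the conditional laws of the second
    point given the index i, whose average is mu
    ([wasserstein_le_plan_cost], [plan_of_wasserstein_lt]).  In this form two
    couplings with the same mu are glued without disintegrating over mu: the
    Radon-Nikodym theorem yields the posterior probability g j v of the index j
    given the middle point v ([posterior_exists]), and sending the atom x i to
    y j with weight \int (g j) d(kappa i) is a coupling of the two empirical laws
    ([wasserstein_glue], [wasserstein_triangle]).  Minkowski's inequality
    reduces to a pointwise inequality with constants adapted to the two radii
    ([powR_add_le]), to be integrated term by term.

    The family kappa is a plan for every configuration of points x, and moving
    the points by at most e increases the cost radius by at most e
    ([plan_cost_shift]).  Hence strict sublevel sets of the distance are open in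
    the sample points, and a set that is open in finitely many real coordinates
    is a countable union of rational boxes
    ([measurable_coordinate_open]).  This places E and F in the
    sigma-algebras generated by their own samples, so that independence applies
    to them, and makes the final event measurable, so that monotonicity of the
    probability applies. *)

(** * Open conditions, norms and powers *)

(** A set of vectors that is open for the supremum distance is the union of the
    countably many boxes with rational centre and radius 1 / (k + 1) that it
    contains.  Stated for an arbitrary measurable type so that it also applies
    to a generated sigma-algebra. *)
Lemma measurable_coordinate_open (d : measure_display) (T : measurableType d)
    (R : realType) (I : finType) (f : I -> T -> R) (S : set (I -> R)) :
  (forall i, measurable_fun setT (f i)) ->
  (forall y, S y -> exists2 e : R, 0 < e &
     forall y', (forall i, `|y i - y' i| < e) -> S y') ->
  measurable [set w | S (fun i => f i w)].
Proof.
move=> mf openS.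
pose B (rk : {ffun I -> rat} * nat) :=
  [set y : I -> R | forall i, `|ratr (rk.1 i) - y i| < rk.2.+1%:R^-1].
pose F (rk : {ffun I -> rat} * nat) :=
  if `[< B rk `<=` S >] then [set w | B rk (fun i => f i w)] else set0.
have -> : [set w | S (fun i => f i w)] = \bigcup_rk F rk.
  apply/seteqP; split => [w /= Sw|w [rk _]]; last first.
    by rewrite /F; case: asboolP => // sub /sub.
  have [e e0 eS] := openS _ Sw.
  have [k] : exists k, k.+1%:R^-1 < e / 2.
    have e2 : 0 < e / 2 by lra.
    have [k] := ltr_add_invr e2; rewrite add0r => ke; by exists k.
  have k0 : 0 < k.+1%:R^-1 :> R by rewrite invr_gt0 ltr0n.
  set h : R := k.+1%:R^-1 in k0 * => he.
  have /choice[r rP] : forall i, exists r : rat, `|ratr r - f i w| < h.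
    move=> i; have [|r] := @rat_in_itvoo R (f i w - h) (f i w + h); first by lra.
    rewrite in_itv /= => /andP[r1 r2]; exists r.
    by rewrite ltr_norml; apply/andP; split; lra.
  exists ([ffun i => r i], k) => //; rewrite /F; case: asboolP; last first.
    case=> y By; apply: eS => i; move: (By i) (rP i); rewrite /= -/h ffunE => b1 b2.
    have -> : f i w - y i = - (ratr (r i) - f i w) + (ratr (r i) - y i) by ring.
    apply: (le_lt_trans (ler_normD _ _)); rewrite normrN.
    by lra.
  by move=> _ i /=; rewrite ffunE.
apply: countable_bigcupT_measurable => [|rk]; first exact: countableP.
rewrite /F; case: asboolP => // _.
have -> : [set w | B rk (fun i => f i w)] =
    \bigcap_(i in [set: I]) [set w | `|ratr (rk.1 i) - f i w| < rk.2.+1%:R^-1].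
  by apply/seteqP; split => w /= h i; [move=> _; exact: h|exact: h].
apply: fin_bigcap_measurable => [|i _]; first exact: finite_finset.
rewrite -[X in measurable X]setTI.
apply: (measurable_fun_ltr (f := fun w => `|ratr (rk.1 i) - f i w : R|)
  (g := cst (rk.2.+1%:R^-1)) _ _ measurableT (Y := [set true])) => //.
by apply: measurableT_comp => //; exact: measurable_funB.
Qed.

Lemma measurable_coord (R : realType) (p : nat) (j : 'I_p) :
  measurable_fun setT (fun v : borel_vec R p => vec_of v ord0 j).
Proof.
apply: (measurability _ (RGenOpens.measurableE R)) => _ [_ [a [b ->]] <-].
rewrite setTI; apply: sub_sigma_algebra.
apply: (open_comp (f := fun M : 'rV[R]_p => M ord0 j)) => [M _|].
  exact: coord_continuous.
exact: itv_open.
Qed.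

Section Norm.
Context {R : realType} {p : nat} {nrm : 'rV[R]_p -> R}.
Hypothesis hnrm : is_norm nrm.

Lemma nrm0 : nrm 0 = 0.
Proof. by rewrite -(scale0r 0) (norm_scale hnrm) normr0 mul0r. Qed.

Lemma nrmN v : nrm (- v) = nrm v.
Proof. by rewrite -scaleN1r (norm_scale hnrm) normrN1 mul1r. Qed.

Lemma nrmB_sym u v : nrm (u - v) = nrm (v - u).
Proof. by rewrite -opprB nrmN. Qed.

Lemma nrm_ge0 v : 0 <= nrm v.
Proof.
have := norm_triangle hnrm v (- v); rewrite subrr nrm0 nrmN => h; lra.
Qed.

Lemma nrmB_triangle u v w : nrm (u - w) <= nrm (u - v) + nrm (v - w).
Proof. by rewrite -(subrKA v u); exact: norm_triangle. Qed.

(** The half of the equivalence of norms that makes [nrm] continuous: expand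
    the vector in the standard basis. *)
Lemma nrm_le_coord : exists2 K : R, 0 < K &
  forall (v : 'rV[R]_p) (e : R), 0 <= e -> (forall j, `|v ord0 j| <= e) -> nrm v <= K * e.
Proof.
pose S := \sum_(j < p) nrm (delta_mx ord0 j : 'rV[R]_p).
have S0 : 0 <= S by apply: sumr_ge0 => j _; exact: nrm_ge0.
(* The summand 1 makes the constant positive in dimension 0. *)
exists (1 + S) => [|v e e0 ve]; first lra.
suff : nrm v <= S * e by nra.
rewrite {1}(row_sum_delta v) /S mulr_suml.
elim/big_rec2 : _ => [|j y x _ xy]; first by rewrite nrm0.
apply: (le_trans (norm_triangle hnrm _ _)); apply: lerD => //.
by rewrite (norm_scale hnrm) mulrC ler_wpM2l ?nrm_ge0.
Qed.

Let row_of_coords (v : 'rV[R]_p) : \row_j v ord0 j = v.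
Proof. by apply/rowP => j; rewrite mxE. Qed.

Lemma measurable_nrm_comp (d : measure_display) (T : measurableType d)
    (g : T -> 'rV[R]_p) :
  (forall j, measurable_fun setT (fun w => g w ord0 j)) ->
  measurable_fun setT (fun w => nrm (g w)).
Proof.
move=> mg; apply: (measurability _ (RGenCInfty.measurableE R)).
move=> _ [_ [c ->] <-]; rewrite setTI -[X in measurable X]setCK.
apply: measurableC.
have -> : ~` ((fun w => nrm (g w)) @^-1` `[c, +oo[%classic) =
    [set w | [set y : 'I_p -> R | nrm (\row_j y j) < c]
               (fun j => g w ord0 j)].
  apply/seteqP; split => w /=; rewrite in_itv /= andbT.
    by move/negP; rewrite -ltNge row_of_coords.
  by rewrite row_of_coords => wc; apply/negP; rewrite -ltNge.
have [K K0 leK] := nrm_le_coord.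
apply: measurable_coordinate_open => // y /= yc.
exists ((c - nrm (\row_j y j)) / (2 * K)) => [|y' yy'].
  by rewrite divr_gt0 ?mulr_gt0 ?subr_gt0.
have := norm_triangle hnrm (\row_j y j) (\row_j y' j - \row_j y j).
rewrite addrC subrK => /le_lt_trans; apply.
rewrite -ltrBrDl (@le_lt_trans _ _ (K * ((c - nrm (\row_j y j)) / (2 * K))))//.
  apply: leK => [|j]; first by rewrite divr_ge0 ?mulr_ge0 ?subr_ge0 ?ltW.
  by rewrite !mxE distrC ltW.
have -> : K * ((c - nrm (\row_j y j)) / (2 * K)) = (c - nrm (\row_j y j)) / 2.
  by field; rewrite gt_eqF.
lra.
Qed.

End Norm.

(** Convexity of the q-th power at the weights s / (s + t) and t / (s + t).
    Choosing s and t as the two radii makes the right-hand side integrate to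
    (s + t) `^ q, which is Minkowski's inequality without roots of integrals. *)
Lemma powR_add_le (R : realType) (q s t : R) : 1 <= q -> 0 < s -> 0 < t ->
  exists A B : R, [/\ 0 <= A, 0 <= B,
    A * s `^ q + B * t `^ q = (s + t) `^ q &
    forall u v : R, 0 <= u -> 0 <= v -> (u + v) `^ q <= A * u `^ q + B * v `^ q].
Proof.
move=> q1 s0 t0; have st0 : 0 < s + t by rewrite addr_gt0.
pose l := s / (s + t).
have l0 : 0 <= l by rewrite divr_ge0 ?ltW.
have l1 : l <= 1 by rewrite ler_pdivrMr// mul1r lerDl ltW.
have sq0 : s `^ q != 0 by rewrite gt_eqF ?powR_gt0.
have tq0 : t `^ q != 0 by rewrite gt_eqF ?powR_gt0.
exists (l * (s + t) `^ q / s `^ q), ((1 - l) * (s + t) `^ q / t `^ q); split.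
- by apply: divr_ge0; [apply: mulr_ge0 => //|]; exact: powR_ge0.
- by rewrite divr_ge0 ?mulr_ge0 ?powR_ge0 ?subr_ge0.
- by rewrite !divfK// -mulrDl (addrC l) subrK mul1r.
move=> u v u0 v0.
have us0 : 0 <= u / s by rewrite divr_ge0// ltW.
have vt0 : 0 <= v / t by rewrite divr_ge0// ltW.
have := @convex_powR R q q1 (Itv01 l0 l1) (u / s) (v / t).
rewrite !inE /= !in_itv /= !andbT => /(_ us0 vt0).
set c := conv _ _ _; have -> : c = (u + v) / (s + t) :> R.
  rewrite [LHS]convRE /= /unstable.onem /l.
  by field; rewrite !gt_eqF.
have div_powR x y : 0 <= x -> 0 < y -> (x / y) `^ q = x `^ q / y `^ q.
  move=> x0 y0; have yq0 : y `^ q != 0 by rewrite gt_eqF ?powR_gt0.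
  apply: (mulIf yq0); rewrite divfK// -powRM ?divr_ge0 ?(ltW y0)//.
  by rewrite divfK// gt_eqF.
rewrite !div_powR ?addr_ge0// ler_pdivrMr ?powR_gt0// => /le_trans; apply.
rewrite convRE /= /unstable.onem le_eqVlt; apply/orP; left; apply/eqP.
by ring.
Qed.

(** * Mixtures, image measures and atoms *)

Section Mixtures.
Local Open Scope ereal_scope.

(** The components are arbitrary measures, so that one lemma builds discrete
    laws, couplings and normalised restrictions. *)
Lemma mixture_exists (d : measure_display) (T : measurableType d)
    (R : realType) (n : nat) (c : 'I_n -> R)
    (m : 'I_n -> {measure set T -> \bar R}) :
  (forall i, 0 <= c i)%R -> \sum_(i < n) (c i)%:E * m i setT = 1 ->
  exists mu : probability T R,
    (forall A, mu A = \sum_(i < n) (c i)%:E * m i A) /\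
    (forall h : T -> \bar R, (forall x, 0 <= h x) -> measurable_fun setT h ->
       \int[mu]_x h x = \sum_(i < n) (c i)%:E * \int[m i]_x h x).
Proof.
move=> c0 m1.
pose D (k : nat) : {measure set T -> \bar R} :=
  if insub k is Some i then mscale (NngNum (c0 i)) (m i) else mzero.
have DE (i : 'I_n) : D i = mscale (NngNum (c0 i)) (m i).
  by rewrite /D valK.
have ME A : msum D n A = \sum_(i < n) (c i)%:E * m i A.
  by apply: eq_bigr => i _; rewrite DE.
have NE A : mnormalize (msum D n) (point : probability T R) A = msum D n A.
  have M1 : msum D n setT = 1 by rewrite ME.
  rewrite /mnormalize /= M1 /=.
  by rewrite onee_eq0 /= invr1 mule1.
exists (mnormalize (msum D n) point); split => [A|h h0 mh].
  by rewrite -ME; exact: NE.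
rewrite (eq_measure_integral (msum D n)) => [|A _ _]; last exact: NE.
rewrite ge0_integral_measure_sum//; apply: eq_bigr => i _.
by rewrite DE ge0_integral_mscale.
Qed.

Lemma ge0_integral_mrestr (d : measure_display) (T : measurableType d)
    (R : realType) (m : {measure set T -> \bar R}) (D : set T)
    (mD : measurable D) (h : T -> \bar R) :
  (forall x, 0 <= h x) -> measurable_fun setT h ->
  \int[mrestr m mD]_x h x = \int[m]_(x in D) h x.
Proof.
move=> h0 mh; rewrite (@ge0_negligible_integral _ _ _ _ setT (~` D))//.
- rewrite setTD setCK; apply: eq_measure_integral => A mA AD.
  by rewrite /= /mrestr setIidl.
- exact: measurableC.
- by rewrite /= /mrestr setICl measure0.
Qed.

Lemma pushforward_exists (d d' : measure_display) (X : measurableType d)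
    (Y : measurableType d') (R : realType) (m : {measure set X -> \bar R})
    (phi : X -> Y) : measurable_fun setT phi ->
  exists nu : {measure set Y -> \bar R},
    (forall A, nu A = m (phi @^-1` A)) /\
    (forall h : Y -> \bar R, (forall y, 0 <= h y) -> measurable_fun setT h ->
       \int[nu]_y h y = \int[m]_x h (phi x)).
Proof.
move=> mphi; unshelve eexists (pushforward m phi); first exact: mphi.
by split => // h h0 mh; rewrite ge0_integral_pushforward.
Qed.

(** When phi takes only the values x i, the space splits into the fibres of
    phi.  The sum runs over indices, so a value repeated k times is met k
    times and each of its fibres is weighted by 1 / k. *)
Lemma integral_atoms (d d' : measure_display) (U : measurableType d)
    (V : measurableType d') (R : realType) (m : {measure set U -> \bar R})
    (phi : U -> V) (n : nat) (x : 'I_n -> V) (h : U -> \bar R) :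
  measurable_fun setT phi -> (forall v : V, measurable [set v]) ->
  m (phi @^-1` ~` range x) = 0 ->
  (forall z, 0 <= h z) -> measurable_fun setT h ->
  \int[m]_z h z = \sum_(i < n) ((\sum_(j < n) \1_[set x i] (x j))^-1)%:E *
                    \int[m]_(z in phi @^-1` [set x i]) h z.
Proof.
move=> mphi m1 mx0 h0 mh.
pose k v : R := (\sum_(j < n) \1_[set v] (x j))%R.
have mD i : measurable (phi @^-1` [set x i]).
  by rewrite -[X in measurable X]setTI; exact: mphi.
have k0 v : (0 <= k v)%R by apply: sumr_ge0 => j _.
have mhi i : measurable_fun setT (h \_ (phi @^-1` [set x i])).
  by apply/(measurable_restrictT _ _).1 => //; exact: measurable_funTS.
have h0i i z : 0 <= (h \_ (phi @^-1` [set x i])) z by exact: erestrict_ge0.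
under [RHS]eq_bigr => i _.
  rewrite -/(k (x i)) integral_mkcond -ge0_integralZl//.
    over.
  by rewrite lee_fin invr_ge0.
rewrite -ge0_integral_sum//=; first last.
- by move=> i z _; rewrite mule_ge0// lee_fin invr_ge0.
- by move=> i; exact: emeasurable_funM.
apply: ge0_ae_eq_integral => //.
- by apply: emeasurable_sum => i; exact: emeasurable_funM.
- by move=> z _; apply: sume_ge0 => i _; rewrite mule_ge0// lee_fin invr_ge0.
exists (phi @^-1` ~` range x); split => //.
  rewrite -[X in measurable X]setTI; apply: mphi => //; apply: measurableC.
  rewrite -(bigcup_imset1 setT x).
  by apply: fin_bigcup_measurable => // ; exact: finite_finset.
move=> z /= hz [j _ xj]; apply: hz => _.
have kz0 : k (phi z) != 0%R.
  rewrite /k -xj (bigD1 j)//= indicE mem_set//= gt_eqF// ltr_wpDr//.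
  by apply: sumr_ge0.
rewrite [RHS](eq_bigr (fun i => ((k (phi z))^-1 * \1_[set phi z] (x i))%:E * h z)).
  rewrite -ge0_sume_distrl => [|i _]; last by rewrite lee_fin mulr_ge0 ?invr_ge0.
  by rewrite sumEFin -mulr_sumr mulVf// mul1e.
move=> i _; rewrite patchE /= indicE.
have [xz|xz] := pselect (phi z = x i).
  by rewrite !mem_set//= xz mulr1.
by rewrite !memNset//= ?mulr0 ?mule0 ?mul0e// => /esym.
Qed.
End Mixtures.

(** * Disintegration over an empirical law *)

Section Disintegration.
Local Open Scope ereal_scope.

(** The law kappa i is the conditional law of the second point given that the
    first one is x i, that is, the normalised restriction of Pi to the fibre
    over x i; indices with the same point get the same law. *)
Lemma disintegration (d d' : measure_display) (V : measurableType d)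
    (S : measurableType d') (R : realType) (n : nat) (x : 'I_n -> V)
    (Pi : probability (V * S)%type R) :
  (0 < n)%N -> (forall v : V, measurable [set v]) ->
  (forall A, measurable A -> Pi (A `*` setT) = empirical x A) ->
  exists kappa : 'I_n -> probability S R,
    forall h : V * S -> \bar R, (forall z, 0 <= h z) -> measurable_fun setT h ->
    \int[Pi]_z h z =
      \sum_(i < n) (n%:R^-1)%:E * \int[kappa i]_s h (x i, s).
Proof.
move=> n0 m1 PiE.
pose k v : R := (\sum_(j < n) \1_[set v] (x j))%R.
have nR0 : n%:R != 0%R :> R by rewrite pnatr_eq0 -lt0n.
have k0 i : (0 < k (x i))%R.
  rewrite /k (bigD1 i)//= indicE mem_set//= ltr_wpDr//.
  by apply: sumr_ge0.
have fstE A : fst @^-1` A = A `*` setT :> set (V * S).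
  by apply/seteqP; split => z /=; [|case].
have mD i : measurable (fst @^-1` [set x i] : set (V * S)).
  by rewrite fstE; exact: measurableX.
have empE v : empirical x [set v] = (n%:R^-1 * k v)%:E.
  by rewrite /empirical EFinM /k -sumEFin.
have mrange : measurable (range x).
  rewrite -(bigcup_imset1 setT x).
  by apply: fin_bigcup_measurable => //; exact: finite_finset.
have msnd : measurable_fun [set: V * S] snd by exact: measurable_snd.
have /choice[kappa kappaE] : forall i, exists kap : probability S R,
    forall g : S -> \bar R, (forall s, 0 <= g s) -> measurable_fun setT g ->
    \int[kap]_s g s =
      (n%:R / k (x i))%:E * \int[Pi]_(z in fst @^-1` [set x i]) g z.2.
  move=> i.
  have [nu [nuE int_nu]] := @pushforward_exists _ _ _ _ _ (mrestr Pi (mD i)) _ msnd.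
  (* The restriction has mass k (x i) / n; a one-component mixture with the
     inverse weight normalises it. *)
  have [||kap [_ kapE]] := @mixture_exists _ S R 1
      (fun=> n%:R / k (x i))%R (fun=> nu).
  - by move=> _; rewrite divr_ge0// ltW.
  - rewrite big_ord1 nuE /= /mrestr preimage_setT setTI fstE PiE//.
    by rewrite empE -EFinM; congr EFin; field; rewrite nR0 gt_eqF.
  exists kap => g g0 mg; rewrite kapE// big_ord1 int_nu//.
  by rewrite ge0_integral_mrestr//; exact: measurableT_comp.
exists kappa => h h0 mh.
have x_as : Pi (fst @^-1` ~` range x) = 0.
  rewrite fstE PiE /empirical; last exact: measurableC.
  rewrite big1 ?mule0// => i _; rewrite diracE memNset//=.
  by apply; exists i.
rewrite (@integral_atoms _ _ _ _ _ _ fst n x)//; apply: eq_bigr => i _.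
rewrite kappaE//; last exact: measurableT_comp.
rewrite muleA -EFinM mulrA mulVf// mul1r; congr (_ * _).
by apply: eq_integral => -[v s]; rewrite inE /= => ->.
Qed.

End Disintegration.

(** * Couplings with an empirical law as families of conditional laws *)

Definition averages {d : measure_display} {T : measurableType d} {R : realType}
    {n : nat} (kappa : 'I_n -> probability T R) (mu : set T -> \bar R) : Prop :=
  forall B, measurable B ->
    mu B = (\sum_(i < n) (n%:R^-1)%:E * kappa i B)%E.

(** The q-th power of the transport cost of the plan that draws an index i
    uniformly and moves x i to a point drawn from kappa i. *)
Definition plan_cost {R : realType} {p : nat} (nrm : 'rV[R]_p -> R) (q : R)
    {n : nat} (x : 'I_n -> borel_vec R p)
    (kappa : 'I_n -> probability (borel_vec R p) R) : \bar R :=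
  (\sum_(i < n) (n%:R^-1)%:E *
     \int[kappa i]_v (nrm (vec_of (x i) - vec_of v) `^ q)%:E)%E.

Lemma sum_inv_card (R : realType) (n : nat) : (0 < n)%N ->
  (\sum_(i < n) (n%:R^-1)%:E = 1 :> \bar R)%E.
Proof.
move=> n0; rewrite sumEFin sumr_const card_ord -[X in X *+ _]mul1r -mulrnAr.
by rewrite -mulr_natr mul1r mulVf// pnatr_eq0 -lt0n.
Qed.

Lemma averages_integral (d : measure_display) (T : measurableType d)
    (R : realType) (n : nat) (kappa : 'I_n -> probability T R)
    (mu : {measure set T -> \bar R}) (h : T -> \bar R) :
  (0 < n)%N -> averages kappa mu ->
  (forall v, 0 <= h v)%E -> measurable_fun setT h ->
  (\int[mu]_v h v = \sum_(i < n) (n%:R^-1)%:E * \int[kappa i]_v h v)%E.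
Proof.
move=> n0 avg h0 mh.
have [||nu [nuE int_nu]] := @mixture_exists _ T R n (fun=> n%:R^-1) kappa.
- by move=> _; rewrite invr_ge0.
- rewrite -[RHS](sum_inv_card R n n0); apply: eq_bigr => i _.
  by rewrite [X in (_ * X)%E](@probability_setT _ _ _ (kappa i)) mule1.
rewrite -int_nu//; apply: eq_measure_integral => A mA _.
by rewrite avg//; exact/esym/nuE.
Qed.

Lemma measurable_vec1 (R : realType) (p : nat) (v : borel_vec R p) :
  measurable [set v].
Proof.
have -> : [set v] = \bigcap_(j in [set: 'I_p])
    [set u | vec_of u ord0 j \in [set vec_of v ord0 j]].
  apply/seteqP; split => [_ -> j _|u uv] /=; first by rewrite inE.
  by apply/rowP => j; have /set_mem := uv j I.
apply: fin_bigcap_measurable => [|j _]; first exact: finite_finset.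
have -> : [set u | vec_of u ord0 j \in [set vec_of v ord0 j]] =
    (fun u : borel_vec R p => vec_of u ord0 j) @^-1` [set vec_of v ord0 j].
  by apply/seteqP; split => u /=; rewrite inE.
rewrite -[X in measurable X]setTI.
exact: (measurable_coord _ _ j measurableT).
Qed.

Section Transport.
Context {R : realType} {p : nat} {nrm : 'rV[R]_p -> R}.
Hypothesis hnrm : is_norm nrm.
Context {q : R}.
Hypothesis hq : 1 <= q.
Local Notation V := (borel_vec R p).

Let q0 : 0 < q. Proof. exact: lt_le_trans hq. Qed.
Let q_neq0 : q != 0. Proof. by rewrite gt_eqF. Qed.

Lemma measurable_transport_cost :
  measurable_fun setT
    (fun z : V * V => (nrm (vec_of z.1 - vec_of z.2) `^ q)%:E).
Proof.
apply/measurable_EFinP.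
apply: (measurableT_comp (f := fun r : R => r `^ q)).
  exact: measurable_powR.
apply: (measurable_nrm_comp hnrm) => j.
under eq_fun do rewrite !mxE.
apply: measurable_funB.
  exact: (measurableT_comp (measurable_coord R p j) measurable_fst).
exact: (measurableT_comp (measurable_coord R p j) measurable_snd).
Qed.

Lemma measurable_transport_costr (u : V) :
  measurable_fun setT
    (fun v : V => (nrm (vec_of u - vec_of v) `^ q)%:E).
Proof.
exact: (measurableT_comp measurable_transport_cost (pair1_measurable u)).
Qed.

(** The mixture of the images of kappa i under v |-> (x i, v) is a coupling
    whose cost is the cost of the plan. *)
Lemma wasserstein_le_plan_cost (n : nat) (x : 'I_n -> V)
    (mu : {measure set V -> \bar R}) (kappa : 'I_n -> probability V R) (s : R) :
  (0 < n)%N -> 0 <= s -> averages kappa mu ->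
  (plan_cost nrm q x kappa <= (s `^ q)%:E)%E ->
  (wasserstein nrm q (empirical x) mu <= s%:E)%E.
Proof.
move=> n0 s0 avg cost_le.
have /choice[m mP] : forall i, exists m : {measure set (V * V) -> \bar R},
    (forall A, m A = kappa i (pair (x i) @^-1` A)) /\
    (forall h : V * V -> \bar R, (forall y, 0 <= h y)%E -> measurable_fun setT h ->
       \int[m]_y h y = \int[kappa i]_v h (x i, v))%E.
  by move=> i; apply: pushforward_exists; exact: pair1_measurable.
have [||Pi [PiE int_Pi]] := @mixture_exists _ _ R n (fun=> n%:R^-1) m.
- by move=> _; rewrite invr_ge0.
- rewrite -[RHS](sum_inv_card R n n0); apply: eq_bigr => i _.
  by rewrite (mP i).1 preimage_setT probability_setT mule1.
have cPi : couplings (empirical x) mu Pi.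
  move=> A mA; rewrite !PiE; split.
    rewrite [RHS]/= /empirical ge0_sume_distrr//; apply: eq_bigr => i _.
    rewrite (mP i).1 diracE; congr (_ * _)%E.
    have [xA|xA] := boolP (x i \in A).
      rewrite (_ : _ @^-1` _ = setT) ?probability_setT//.
      by apply/seteqP; split => v //= _; split=> //; exact: set_mem.
    rewrite (_ : _ @^-1` _ = set0) ?measure0//.
    by apply/seteqP; split => v //= -[/mem_set]; rewrite (negbTE xA).
  rewrite avg//; apply: eq_bigr => i _; rewrite (mP i).1.
  by congr (_ * kappa i _)%E; apply/seteqP; split => v //= [].
rewrite /wasserstein -(powRr1 s0) -(divff q_neq0) powRrM -poweR_EFin.
apply: gt0_ler_poweR; rewrite ?invr_ge0 ?(ltW q0)//.
- rewrite in_itv /= leey andbT; apply: le_ereal_inf_tmp => _ [Pi' _ <-].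
  by apply: integral_ge0 => z _; rewrite lee_fin powR_ge0.
- by rewrite in_itv /= leey andbT lee_fin powR_ge0.
apply: le_trans cost_le.
suff -> : plan_cost nrm q x kappa =
    (\int[Pi]_z (nrm (vec_of z.1 - vec_of z.2) `^ q)%:E)%E.
  by apply: ereal_inf_lbound; exists Pi.
rewrite int_Pi; last exact: measurable_transport_cost.
  apply: eq_bigr => i _; rewrite (mP i).2//.
    by move=> z; rewrite lee_fin powR_ge0.
  exact: measurable_transport_cost.
by move=> z; rewrite lee_fin powR_ge0.
Qed.

(** Disintegrate a nearly optimal coupling; the strict inequality leaves room
    for a positive radius t below s. *)
Lemma plan_of_wasserstein_lt (n : nat) (x : 'I_n -> V)
    (mu : {measure set V -> \bar R}) (s : R) :
  (0 < n)%N -> (wasserstein nrm q (empirical x) mu < s%:E)%E ->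
  exists (kappa : 'I_n -> probability V R) (t : R),
    [/\ averages kappa mu, 0 < t < s &
        (plan_cost nrm q x kappa <= (t `^ q)%:E)%E].
Proof.
move=> n0; rewrite /wasserstein; set I := ereal_inf _ => Is.
have s0 : 0 < s by rewrite -lte_fin (le_lt_trans _ Is)// poweR_ge0.
have I0 : (0 <= I)%E.
  apply: le_ereal_inf_tmp => _ [Pi' _ <-].
  by apply: integral_ge0 => z _; rewrite lee_fin powR_ge0.
have : (I < (s `^ q)%:E)%E.
  rewrite ltNge; apply/negP => sI; move: Is; rewrite ltNge => /negP; apply.
  rewrite -(powRr1 (ltW s0)) -(divff q_neq0) powRrM -poweR_EFin.
  apply: gt0_ler_poweR; rewrite ?invr_ge0 ?(ltW q0)// in_itv /= leey andbT//.
  by rewrite lee_fin powR_ge0.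
case/ereal_inf_lt => _ [Pi cPi <-] Pi_lt.
have [kappa kappaE] := @disintegration _ _ V V R n x Pi n0
  (@measurable_vec1 R p) (fun A mA => (cPi A mA).1).
have costE : (\int[Pi]_z (nrm (vec_of z.1 - vec_of z.2) `^ q)%:E =
    plan_cost nrm q x kappa)%E.
  rewrite kappaE//; last exact: measurable_transport_cost.
  by move=> z; rewrite lee_fin powR_ge0.
rewrite costE in Pi_lt.
have c0 : (0 <= plan_cost nrm q x kappa)%E.
  rewrite -costE; apply: integral_ge0 => z _; by rewrite lee_fin powR_ge0.
have cfin : plan_cost nrm q x kappa \is a fin_num.
  by rewrite ge0_fin_numE// (lt_trans Pi_lt)// ltry.
pose r := fine (plan_cost nrm q x kappa).
have r0 : 0 <= r by exact: fine_ge0.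
have cr : plan_cost nrm q x kappa = r%:E by rewrite fineK.
rewrite cr lte_fin in Pi_lt.
exists kappa, (Num.max (r `^ q^-1) (s / 2)); split.
- move=> B mB; rewrite -(cPi B mB).2.
  have mTB : measurable (setT `*` B : set (V * V)) by exact: measurableX.
  rewrite -[setT `*` B]setIT -integral_indic// kappaE.
  + apply: eq_bigr => i _; congr (_ * _)%E.
    rewrite -[in RHS](setIT B) -integral_indic//.
    apply: eq_integral => v _; rewrite !indicE; congr ((nat_of_bool _)%:R%:E).
    by apply/idP/idP => /set_mem; [case=> _ /mem_set|move=> Bv; exact/mem_set].
  + by move=> z; rewrite lee_fin.
  + exact/measurable_EFinP/measurable_indic.
- rewrite lt_max gt_max; apply/andP; split; first by apply/orP; right; lra.
  apply/andP; split; last by lra.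
  rewrite -[ltRHS](powRr1 (ltW s0)) -(divff q_neq0) powRrM.
  by rewrite gt0_ltr_powR ?invr_gt0 ?nnegrE ?powR_ge0.
rewrite cr lee_fin.
rewrite -[leLHS](powRr1 r0) -(mulVf q_neq0) powRrM.
by rewrite ge0_ler_powR ?nnegrE ?powR_ge0 ?le_max ?lexx// ?(ltW q0)// powR_ge0.
Qed.

End Transport.

(** * Posterior probabilities of an index *)

(** Bayes' rule: g j v is the probability that the index is j given the point
    v, when j is uniform and v is drawn from rho j.  It is 1 / m times the
    Radon-Nikodym density of rho j; the densities add up to m only almost
    everywhere, and on the exceptional set the uniform law on the indices is
    used, so that no null set remains in the conclusion. *)
Lemma posterior_exists (d : measure_display) (T : measurableType d)
    (R : realType) (m : nat) (rho : 'I_m -> probability T R)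
    (mu : probability T R) :
  (0 < m)%N -> averages rho mu ->
  exists g : 'I_m -> T -> R,
    [/\ forall j v, 0 <= g j v,
        forall v, \sum_(j < m) g j v = 1,
        forall j, measurable_fun setT (g j) &
        forall j (h : T -> \bar R), (forall v, 0 <= h v)%E ->
          measurable_fun setT h ->
          (\int[mu]_v ((g j v)%:E * h v) =
           (m%:R^-1)%:E * \int[rho j]_v h v)%E].
Proof.
move=> m0 avg.
have mV0 : 0 <= m%:R^-1 :> R by rewrite invr_ge0.
have dom j : rho j `<< mu.
  apply/null_content_dominatesP => E mE muE0.
  have : ((m%:R^-1)%:E * rho j E <= 0)%E.
    rewrite -muE0 [leRHS]avg// (bigD1 j)//= leeDl// sume_ge0// => k _.
    by rewrite mule_ge0.
  rewrite pmule_rle0 ?lte_fin ?invr_gt0 ?ltr0n// => rho0.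
  by apply/eqP; rewrite eq_le rho0 measure_ge0.
pose f j := Radon_Nikodym_SigmaFinite.f (rho j) mu.
have f0 j v : (0 <= f j v)%E.
  exact: (Radon_Nikodym_SigmaFinite.f_ge0 (dom j)).
have ffin j v : f j v \is a fin_num.
  exact: (Radon_Nikodym_SigmaFinite.f_fin_num (dom j)).
have mf j : measurable_fun setT (f j).
  exact: measurable_int (Radon_Nikodym_SigmaFinite.f_integrable (dom j)).
pose g0 j v := m%:R^-1 * fine (f j v).
have g00 j v : 0 <= g0 j v by rewrite mulr_ge0 ?fine_ge0.
have g0E j v : ((g0 j v)%:E = (m%:R^-1)%:E * f j v)%E.
  by rewrite EFinM fineK.
have mg0 j : measurable_fun setT (g0 j).
  by apply: measurable_funM => //; exact: measurableT_comp.
pose G v := \sum_(j < m) g0 j v.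
have mG : measurable_fun setT G by exact: measurable_sum.
have G1 : ae_eq mu setT (cst 1%E) (EFin \o G).
  apply: integral_ae_eq => //.
  - exact: finite_measure_integrable_cst.
  - exact/measurable_EFinP.
  move=> E _ mE; rewrite integral_cst// mul1e.
  under [RHS]eq_integral do rewrite /= -sumEFin.
  rewrite ge0_integral_sum//.
  - rewrite [LHS]avg//; apply: eq_bigr => j _.
    under [RHS]eq_integral do rewrite g0E.
    rewrite ge0_integralZl//.
    + by rewrite (Radon_Nikodym_SigmaFinite.f_integral (dom j) mE).
    + exact: measurable_funTS.
  - by move=> j; apply/measurable_EFinP; exact: measurable_funTS.
  - by move=> j v _; rewrite lee_fin.
exists (fun j v => if G v == 1 then g0 j v else m%:R^-1); split.
- by move=> j v; case: ifP.
- move=> v; case: (G v =P 1) => [//|_].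
  by rewrite sumr_const card_ord -[LHS]mulr_natl divff// pnatr_eq0 -lt0n.
- by move=> j; apply: measurable_fun_ifT => //; exact: measurable_fun_eqr.
move=> j h h0 mh.
rewrite (@ge0_ae_eq_integral _ _ _ mu setT _ (fun v => (m%:R^-1)%:E * (h v * f j v))%E)//.
- rewrite ge0_integralZl//.
  + by rewrite (Radon_Nikodym_SigmaFinite.change_of_variables (dom j)).
  + exact: emeasurable_funM.
  + by move=> v _; rewrite mule_ge0.
- apply: emeasurable_funM => //; apply/measurable_EFinP.
  by apply: measurable_fun_ifT => //; exact: measurable_fun_eqr.
- by apply: emeasurable_funM => //; exact: emeasurable_funM.
- by move=> v _; rewrite mule_ge0// lee_fin; case: ifP.
- by move=> v _; rewrite mule_ge0// mule_ge0.
apply: filterS G1 => v /= /(_ I) [Gv] _.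
by rewrite -Gv eqxx g0E -muleA (muleC (f j v)).
Qed.

(** * Gluing two couplings *)

Section Gluing.
Context {R : realType} {p : nat} {nrm : 'rV[R]_p -> R}.
Hypothesis hnrm : is_norm nrm.
Context {q : R}.
Hypothesis hq : 1 <= q.
Local Notation V := (borel_vec R p).
Local Open Scope ereal_scope.

(** Draw v from mu, then i and j independently from their posteriors given v:
    this is a coupling of the uniform laws on the indices, hence of the two
    empirical laws.  The weight of (i, j) is the integral of g j against
    kappa i, and the distance from x i to y j is split at v. *)
Lemma wasserstein_glue (n m : nat) (x : 'I_n -> V) (y : 'I_m -> V)
    (mu : {measure set V -> \bar R})
    (kappa : 'I_n -> probability V R) (rho : 'I_m -> probability V R)
    (s t : R) :
  (0 < n)%N -> (0 < m)%N -> (0 < s)%R -> (0 < t)%R ->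
  averages kappa mu -> averages rho mu ->
  plan_cost nrm q x kappa <= (s `^ q)%:E ->
  plan_cost nrm q y rho <= (t `^ q)%:E ->
  wasserstein nrm q (empirical x) (empirical y) <= (s + t)%:E.
Proof.
move=> n0 m0 s0 t0 avgk avgr costk costr.
have [||P' [P'E _]] := @mixture_exists _ V R m (fun=> m%:R^-1)%R rho.
- by move=> _; rewrite invr_ge0.
- rewrite -[RHS](sum_inv_card R m m0); apply: eq_bigr => i _.
  by rewrite [X in (_ * X)%E](@probability_setT _ _ _ (rho i)) mule1.
have avgr' : averages rho P' by move=> B _; exact: P'E.
have avgk' : averages kappa P' by move=> B mB; rewrite avgr'// -avgr// avgk.
have [g [g0 g1 mg gE]] := @posterior_exists _ V R m rho P' m0 avgr'.
have mgE j : measurable_fun setT (fun v => (g j v)%:E) by exact/measurable_EFinP.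
have gE0 j v : 0 <= (g j v)%:E by rewrite lee_fin.
pose C (u v : V) : \bar R := (nrm (vec_of u - vec_of v) `^ q)%:E.
have C0 u v : 0 <= C u v by rewrite lee_fin powR_ge0.
have mC u : measurable_fun setT (C u) by exact: (measurable_transport_costr hnrm).
have sum_g i : \sum_(j < m) \int[kappa i]_v (g j v)%:E = 1.
  rewrite -ge0_integral_sum// (eq_integral (cst 1)) => [|v _].
    by rewrite integral_cst// mul1e; exact: probability_setT.
  by rewrite sumEFin g1.
have w_fin i j : \int[kappa i]_v (g j v)%:E \is a fin_num.
  rewrite ge0_fin_numE ?integral_ge0//.
  rewrite (@le_lt_trans _ _ 1) ?ltry// -(sum_g i) (bigD1 j)//= leeDl//.
  by apply: sume_ge0 => k _; exact: integral_ge0.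
pose w i j := fine (\int[kappa i]_v (g j v)%:E).
have wE i j : (w i j)%:E = \int[kappa i]_v (g j v)%:E by rewrite fineK.
have w0 i j : (0 <= w i j)%R by rewrite fine_ge0// integral_ge0.
have /choice[kap kapP] : forall i, exists kap : probability V R,
    (forall B, kap B = \sum_(j < m) (w i j)%:E * \d_(y j) B) /\
    (forall h : V -> \bar R, (forall v, 0 <= h v) -> measurable_fun setT h ->
       \int[kap]_v h v = \sum_(j < m) (w i j)%:E * h (y j)).
  move=> i.
  have [//||k [kE int_k]] := @mixture_exists _ V R m (w i)
    (fun j => \d_(y j) : {measure set V -> \bar R}).
    rewrite -[RHS](sum_g i); apply: eq_bigr => j _.
    by rewrite /= diracT mule1 wE.
  exists k; split => // h h0 mh; rewrite int_k//; apply: eq_bigr => j _.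
  by rewrite integral_dirac// diracT mul1e.
have sum_w j (h : V -> \bar R) : (forall v, 0 <= h v) -> measurable_fun setT h ->
    \sum_(i < n) (n%:R^-1)%:E * \int[kappa i]_v ((g j v)%:E * h v) =
    (m%:R^-1)%:E * \int[rho j]_v h v.
  move=> h0 mh; rewrite -gE// (averages_integral _ _ _ _ kappa)// => [v|].
    by rewrite mule_ge0.
  exact: emeasurable_funM.
apply: (wasserstein_le_plan_cost hnrm hq _ _ _ kap) => //.
- by rewrite addr_ge0 ?ltW.
- move=> B mB.
  have w_sum j : \sum_(i < n) (n%:R^-1)%:E * (w i j)%:E = (m%:R^-1)%:E.
    rewrite -[RHS]mule1 -(@probability_setT _ _ _ (rho j)) -[X in _ * X]mul1e.
    rewrite -integral_cst// -sum_w//; apply: eq_bigr => i _; rewrite wE.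
    by under [in RHS]eq_integral do rewrite mule1.
  transitivity (\sum_(i < n) \sum_(j < m)
      ((n%:R^-1)%:E * (w i j)%:E) * \d_(y j) B).
    rewrite exchange_big /= /empirical ge0_sume_distrr//; apply: eq_bigr => j _.
    by rewrite -(w_sum j) ge0_sume_distrl// => i _; rewrite mule_ge0// lee_fin.
  apply: eq_bigr => i _; rewrite (kapP i).1 ge0_sume_distrr//.
    by apply: eq_bigr => j _; rewrite muleA.
  by move=> j _; rewrite mule_ge0// lee_fin.
have [A [B [A0 B0 ABst AB]]] := powR_add_le R q s t hq s0 t0.
pose Z i j := \int[kappa i]_v ((g j v)%:E * C (y j) v).
have Z0 i j : 0 <= Z i j by apply: integral_ge0 => v _; rewrite mule_ge0.
have X0 i : 0 <= \int[kappa i]_v C (x i) v by exact: integral_ge0.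
have step i : \int[kap i]_v C (x i) v <=
    A%:E * \int[kappa i]_v C (x i) v + B%:E * \sum_(j < m) Z i j.
  have -> : \int[kappa i]_v C (x i) v =
      \sum_(j < m) \int[kappa i]_v ((g j v)%:E * C (x i) v).
    rewrite -ge0_integral_sum//; last 2 first.
    - by move=> j; exact: emeasurable_funM.
    - by move=> j v _; rewrite mule_ge0.
    apply: eq_integral => v _; rewrite -ge0_sume_distrl//.
    by rewrite sumEFin g1 mul1e.
  rewrite (kapP i).2//.
  rewrite ge0_sume_distrr => [|j _]; last first.
    by apply: integral_ge0 => v _; rewrite mule_ge0.
  rewrite ge0_sume_distrr// -big_split /=; apply: lee_sum => j _.
  rewrite wE -ge0_integralZr//.
  rewrite /Z -ge0_integralZl//; last 2 first.
  - exact: emeasurable_funM.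
  - by move=> v _; rewrite mule_ge0.
  rewrite -ge0_integralZl//; last 2 first.
  - exact: emeasurable_funM.
  - by move=> v _; rewrite mule_ge0.
  rewrite -ge0_integralD//; last 4 first.
  - by move=> v _; rewrite !mule_ge0// lee_fin.
  - by apply: emeasurable_funM => //; exact: emeasurable_funM.
  - by move=> v _; rewrite !mule_ge0// lee_fin.
  - by apply: emeasurable_funM => //; exact: emeasurable_funM.
  apply: ge0_le_integral => //.
  - by move=> v _; rewrite mule_ge0.
  - exact: emeasurable_funM.
  - by apply: emeasurable_funD; apply: emeasurable_funM => //;
      exact: emeasurable_funM.
  move=> v _; rewrite /C -!EFinM -EFinD lee_fin.
  set a := nrm _; set b := nrm (_ - vec_of v); set c := nrm (_ - vec_of v).
  have abc : (a <= b + c)%R.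
    by rewrite /c (nrmB_sym hnrm); exact: nrmB_triangle.
  have b0 : (0 <= b)%R by exact: nrm_ge0.
  have c0 : (0 <= c)%R by exact: nrm_ge0.
  have : (a `^ q <= A * b `^ q + B * c `^ q)%R.
    apply: (le_trans _ (AB _ _ b0 c0)).
    by rewrite ge0_ler_powR ?nnegrE ?addr_ge0 ?(nrm_ge0 hnrm)// (le_trans _ hq).
  have := g0 j v; nra.
apply: (@le_trans _ _ (A%:E * plan_cost nrm q x kappa +
                       B%:E * plan_cost nrm q y rho)); last first.
  rewrite -ABst EFinD !EFinM.
  by apply: leeD; rewrite lee_wpmul2l// lee_fin.
have -> : plan_cost nrm q y rho =
    \sum_(i < n) (n%:R^-1)%:E * \sum_(j < m) Z i j.
  rewrite [RHS](eq_bigr (fun i => \sum_(j < m) (n%:R^-1)%:E * Z i j)).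
    by rewrite exchange_big; apply: eq_bigr => j _; rewrite sum_w.
  by move=> i _; rewrite ge0_sume_distrr.
rewrite /plan_cost ge0_sume_distrr => [|i _]; last by rewrite mule_ge0.
rewrite ge0_sume_distrr => [|i _]; last by rewrite mule_ge0// sume_ge0.
rewrite -big_split /=; apply: lee_sum => i _.
rewrite !(muleCA _ (n%:R^-1)%:E) -ge0_muleDr; last 2 first.
- by rewrite mule_ge0// lee_fin.
- by rewrite mule_ge0 ?lee_fin// sume_ge0.
by rewrite lee_wpmul2l.
Qed.
End Gluing.

(** * Openness and measurability in the sample points *)

Section Regularity.
Context {R : realType} {p : nat} {nrm : 'rV[R]_p -> R}.
Hypothesis hnrm : is_norm nrm.
Context {q : R}.
Hypothesis hq : 1 <= q.
Local Notation V := (borel_vec R p).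

(** The constraint on kappa does not mention the points, so the same plan
    serves x', and the pointwise triangle inequality with [powR_add_le]
    controls its cost. *)
Lemma plan_cost_shift (n : nat) (x x' : 'I_n -> V)
    (kappa : 'I_n -> probability V R) (t e : R) :
  (0 < n)%N -> 0 < t -> 0 < e ->
  (forall i, nrm (vec_of (x i) - vec_of (x' i)) <= e) ->
  (plan_cost nrm q x kappa <= (t `^ q)%:E)%E ->
  (plan_cost nrm q x' kappa <= ((t + e) `^ q)%:E)%E.
Proof.
move=> n0 t0 e0 xx' cost.
have q0 : 0 <= q by exact: le_trans hq.
have nV0 : 0 <= n%:R^-1 :> R by rewrite invr_ge0.
have [A [B [A0 B0 ABst AB]]] := powR_add_le R q t e hq t0 e0.
have C0 (u v : V) : (0 <= (nrm (vec_of u - vec_of v) `^ q)%:E)%E.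
  by rewrite lee_fin powR_ge0.
have mC := measurable_transport_costr hnrm.
apply: (@le_trans _ _ (A%:E * plan_cost nrm q x kappa + (B * e `^ q)%:E)%E).
  rewrite -[(B * _)%:E]mul1e -(sum_inv_card R n n0).
  rewrite ge0_sume_distrl// /plan_cost ge0_sume_distrr => [|i _]; last first.
    by rewrite mule_ge0// integral_ge0.
  rewrite -big_split /=; apply: lee_sum => i _.
  rewrite muleCA -ge0_muleDr; last 2 first.
  - by rewrite mule_ge0 ?lee_fin// integral_ge0.
  - by rewrite lee_fin mulr_ge0// powR_ge0.
  apply: lee_wpmul2l => //.
  rewrite -ge0_integralZl// -[X in (_ <= _ + X)%E]mule1.
  rewrite -(@probability_setT _ _ _ (kappa i)) -integral_cst//.
  rewrite -ge0_integralD//; last 3 first.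
  - by move=> v _; rewrite mule_ge0// lee_fin.
  - exact: emeasurable_funM.
  - by move=> v _; rewrite lee_fin mulr_ge0// powR_ge0.
  apply: ge0_le_integral => //.
  - by apply: emeasurable_funD => //; exact: emeasurable_funM.
  move=> v _; rewrite -EFinM -EFinD lee_fin.
  apply: (@le_trans _ _ ((nrm (vec_of (x i) - vec_of v) + e) `^ q)).
    rewrite ge0_ler_powR ?nnegrE ?addr_ge0 ?(nrm_ge0 hnrm) ?(ltW e0)//.
    rewrite [leRHS]addrC (le_trans (nrmB_triangle hnrm _ (vec_of (x i)) _))// lerD2r.
    by rewrite (nrmB_sym hnrm).
  exact: (AB _ _ (nrm_ge0 hnrm _) (ltW e0)).
by rewrite -ABst EFinD (EFinM A); apply: leeD => //; apply: lee_wpmul2l.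
Qed.

Lemma wasserstein_lt_shiftl (n : nat) (x : 'I_n -> V)
    (mu : {measure set V -> \bar R}) (c : R) : (0 < n)%N ->
  (wasserstein nrm q (empirical x) mu < c%:E)%E ->
  exists2 e : R, 0 < e &
    forall x' : 'I_n -> V,
      (forall i, nrm (vec_of (x i) - vec_of (x' i)) <= e) ->
      (wasserstein nrm q (empirical x') mu < c%:E)%E.
Proof.
move=> n0 /(plan_of_wasserstein_lt hnrm hq _ _ _ _ n0).
move=> [kappa [t [avg /andP[t0 tc] cost]]].
have e0 : 0 < (c - t) / 2 by rewrite divr_gt0 ?subr_gt0.
exists ((c - t) / 2) => // x' xx'.
apply: (@le_lt_trans _ _ (t + (c - t) / 2)%:E); last by rewrite lte_fin; lra.
apply: (wasserstein_le_plan_cost hnrm hq _ _ _ kappa) => //.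
  by rewrite addr_ge0 ?ltW.
exact: plan_cost_shift cost.
Qed.

(** The target measure moves too, so kappa is no longer a plan for it.  It is
    glued, in the middle law of y, with the plan that moves y' j to y j. *)
Lemma wasserstein_lt_shift (n m : nat) (x : 'I_n -> V) (y : 'I_m -> V)
    (c : R) : (0 < n)%N -> (0 < m)%N ->
  (wasserstein nrm q (empirical x) (empirical y) < c%:E)%E ->
  exists2 e : R, 0 < e &
    forall (x' : 'I_n -> V) (y' : 'I_m -> V),
      (forall i, nrm (vec_of (x i) - vec_of (x' i)) <= e) ->
      (forall j, nrm (vec_of (y j) - vec_of (y' j)) <= e) ->
      (wasserstein nrm q (empirical x') (empirical y') < c%:E)%E.
Proof.
move=> n0 m0 /(plan_of_wasserstein_lt hnrm hq _ _ _ _ n0).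
move=> [kappa [t [avg /andP[t0 tc] cost]]].
(* One third for x, one for y, and one to keep the inequality strict. *)
pose e := (c - t) / 3.
have e0 : 0 < e by rewrite divr_gt0 ?subr_gt0.
exists e => // x' y' xx' yy'.
apply: (@le_lt_trans _ _ (t + e + e)%:E).
  pose rho j : probability V R := \d_(y j).
  apply: (wasserstein_glue hnrm hq _ _ _ _ (empirical y) kappa rho) => //.
  - by rewrite addr_gt0.
  - move=> B mB; rewrite /= /empirical ge0_sume_distrr//.
  - exact: plan_cost_shift cost.
  rewrite -[leRHS]mul1e -(sum_inv_card R m m0) ge0_sume_distrl//.
  apply: lee_sum => j _; apply: lee_wpmul2l => //.
  rewrite integral_dirac//; last exact: (measurable_transport_costr hnrm).
  rewrite diracT mul1e lee_fin (nrmB_sym hnrm).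
  by rewrite ge0_ler_powR ?nnegrE ?(nrm_ge0 hnrm) ?(ltW e0) ?(le_trans ler01 hq).
by rewrite lte_fin /e; lra.
Qed.

(** Coordinates reduce openness for [nrm] to openness for the supremum
    distance on finitely many reals. *)
Lemma measurable_vec_open (d : measure_display) (T : measurableType d)
    (I : finType) (X : I -> T -> V) (S : set (I -> V)) :
  (forall i, measurable_fun setT (X i)) ->
  (forall u, S u -> exists2 e : R, 0 < e &
     forall u', (forall i, nrm (vec_of (u i) - vec_of (u' i)) <= e) -> S u') ->
  measurable [set w | S (fun i => X i w)].
Proof.
move=> mX openS; have [K K0 leK] := nrm_le_coord hnrm.
pose row (f : I * 'I_p -> R) (i : I) : V := \row_j f (i, j).
have -> : [set w | S (fun i => X i w)] =
    [set w | [set f | S (row f)] (fun ij => vec_of (X ij.1 w) ord0 ij.2)].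
  have rowK w : row (fun ij => vec_of (X ij.1 w) ord0 ij.2) = (fun i => X i w).
    by apply/funext => i; apply/rowP => j; rewrite mxE.
  by apply/seteqP; split => w /=; rewrite rowK.
apply: measurable_coordinate_open => [[i j]|f /= Sf].
  exact: (measurableT_comp (measurable_coord R p j) (mX i)).
have [e e0 eS] := openS _ Sf.
exists (e / K) => [|f' ff']; first by rewrite divr_gt0.
apply: eS => i; rewrite -(divfK (lt0r_neq0 K0) e) mulrC.
apply: leK => [|j]; first by rewrite divr_ge0 ?ltW.
by rewrite !mxE ltW.
Qed.

End Regularity.

Lemma measurable_sublevel (d : measure_display) (T : measurableType d)
    (R : realType) (F : T -> \bar R) :
  (forall c : R, measurable [set w | F w < c%:E]%E) ->
  forall c : R, measurable [set w | F w <= c%:E]%E.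
Proof.
move=> mF c.
have -> : ([set w | F w <= c%:E] =
    \bigcap_(k in [set: nat]) [set w | F w < (c + k.+1%:R^-1)%:E])%E.
  apply/seteqP; split => w /= Fc.
    move=> k _ /=; rewrite (le_lt_trans Fc)// lte_fin ltrDl invr_gt0.
    by rewrite ltr0n.
  apply/lee_addgt0Pr => e e0; have [k] := ltr_add_invr e0.
  rewrite add0r => ke; apply: (le_trans (ltW (Fc k I))).
  by rewrite -EFinD lee_fin lerD2l ltW.
by apply: bigcap_measurableType.
Qed.

(** * The detector *)

(** The measurability argument is run with the sigma-algebra generated by the
    samples in place of that of the ambient space. *)
Lemma wasserstein_event_g_sigma (R : realType) (p : nat)
    (nrm : 'rV[R]_p -> R) (q : R) (Omega : pointedType) (n : nat)
    (X : 'I_n -> Omega -> borel_vec R p)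
    (mu : {measure set (borel_vec R p) -> \bar R}) (c : R) :
  is_norm nrm -> 1 <= q -> (0 < n)%N ->
  g_sigma_preimage X
    [set w | (wasserstein nrm q (empirical (fun i => X i w)) mu <= c%:E)%E].
Proof.
move=> hnrm hq n0.
pose G := \big[setU/set0]_(i < n) preimage_set_system setT (X i) measurable.
have mX i : measurable_fun (setT : set (g_sigma_algebraType G))
    (X i : g_sigma_algebraType G -> borel_vec R p).
  move=> _ B mB; apply: sub_sigma_algebra.
  by rewrite /G (bigD1 i)//=; left; exists B.
rewrite -/(measurable : set (set (g_sigma_algebraType G))).
apply: (@measurable_sublevel _ (g_sigma_algebraType G)) => {}c.
apply: (measurable_vec_open hnrm _ _ _ (X : _ -> g_sigma_algebraType G -> _)
  (fun u => wasserstein nrm q (empirical u) mu < c%:E)%E) => // u.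
exact: wasserstein_lt_shiftl.
Qed.

Lemma measurable_wasserstein_le (R : realType) (p : nat)
    (nrm : 'rV[R]_p -> R) (q : R) (d : measure_display)
    (Omega : measurableType d) (n m : nat)
    (X : 'I_n -> Omega -> borel_vec R p) (Y : 'I_m -> Omega -> borel_vec R p)
    (c : R) :
  is_norm nrm -> 1 <= q -> (0 < n)%N -> (0 < m)%N ->
  (forall i, measurable_fun setT (X i)) ->
  (forall j, measurable_fun setT (Y j)) ->
  measurable [set w | (wasserstein nrm q (empirical (fun i => X i w))
                         (empirical (fun j => Y j w)) <= c%:E)%E].
Proof.
move=> hnrm hq n0 m0 mX mY; apply: measurable_sublevel => {}c.
pose XY (k : 'I_n + 'I_m) := match k with inl i => X i | inr j => Y j end.
apply: (measurable_vec_open hnrm _ _ _ XY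
  (fun u => wasserstein nrm q (empirical (u \o inl)) (empirical (u \o inr))
              < c%:E)%E) => [[]//|u].
move=> /(wasserstein_lt_shift hnrm hq _ _ _ _ _ n0 m0)[e e0 eP].
by exists e => // u' uu'; apply: eP => k; exact: uu'.
Qed.

(** Only near-optimal plans are available, so the radii are enlarged by an
    arbitrary e / 2. *)
Lemma wasserstein_triangle (R : realType) (p : nat)
    (nrm : 'rV[R]_p -> R) (q : R) (n m : nat)
    (x : 'I_n -> borel_vec R p) (y : 'I_m -> borel_vec R p)
    (mu : {measure set (borel_vec R p) -> \bar R}) (s t : R) :
  is_norm nrm -> 1 <= q -> (0 < n)%N -> (0 < m)%N ->
  (wasserstein nrm q (empirical x) mu <= s%:E)%E ->
  (wasserstein nrm q (empirical y) mu <= t%:E)%E ->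
  (wasserstein nrm q (empirical x) (empirical y) <= (s + t)%:E)%E.
Proof.
move=> hnrm hq n0 m0 xs yt; apply/lee_addgt0Pr => e e0.
have e2 : 0 < e / 2 by rewrite divr_gt0.
have : (wasserstein nrm q (empirical x) mu < (s + e / 2)%:E)%E.
  by rewrite (le_lt_trans xs)// lte_fin ltrDl.
case/(plan_of_wasserstein_lt hnrm hq _ _ _ _ n0).
move=> kappa [s' [avgk /andP[s'0 s's] costk]].
have : (wasserstein nrm q (empirical y) mu < (t + e / 2)%:E)%E.
  by rewrite (le_lt_trans yt)// lte_fin ltrDl.
case/(plan_of_wasserstein_lt hnrm hq _ _ _ _ m0).
move=> rho [t' [avgr /andP[t'0 t't] costr]].
apply: (le_trans (wasserstein_glue hnrm hq _ _ _ _ _ _ _ _ _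
  n0 m0 s'0 t'0 avgk avgr costk costr)).
by rewrite -EFinD lee_fin; lra.
Qed.

Theorem mainTheorem1 (R : realType) (p : nat)
    (nrm : 'rV[R]_p -> R) (hnrm : is_norm nrm)
    (q : R) (hq : 1 <= q)
    (N T : nat) (hN : (1 <= N)%N) (hT : (1 <= T)%N)
    (beta Delta : R) (hbeta : 0 < beta < 1) (hDelta : beta < Delta < 1)
    (Pr : probability (borel_vec R p) R) (hmean : zero_mean Pr)
    (a b : R) (htail : light_tailed_with nrm q Pr a b)
    (c1 c2 : R) (hc1 : 0 < c1) (hc2 : 0 < c2)
    (hconc : concentration nrm q Pr (conc_radius p q a c1 c2))
    (d : measure_display) (Omega : measurableType d)
    (P : probability Omega R)
    (rB : 'I_N -> {RV P >-> borel_vec R p})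
    (r : nat -> {RV P >-> borel_vec R p})
    (t : nat) (ht : (T <= t)%N)
    (hB : iid_samples Pr rB)
    (hD : iid_samples Pr (fun j : 'I_T => r (t - j)%N))
    (hBD : independent_families rB (fun j : 'I_T => r (t - j)%N)) :
  let eps_B := conc_radius p q a c1 c2 N beta in
  let eps_D := conc_radius p q a c1 c2 T ((Delta - beta) / (1 - beta)) in
  let alpha := eps_B + eps_D in
  let z (w : Omega) : \bar R :=
    wasserstein nrm q (empirical (fun i => rB i w))
                      (empirical (fun j : 'I_T => r (t - j)%N w)) in
  ((1 - Delta)%:E <= P [set w | z w <= alpha%:E])%E.
Proof.
cbv zeta.
set eps_B := conc_radius p q a c1 c2 N beta.
set eps_D := conc_radius p q a c1 c2 T _.
case/andP: hbeta => beta0 beta1; case/andP: hDelta => betaD Delta1.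
pose eta := (Delta - beta) / (1 - beta).
have eta0 : 0 < eta by rewrite divr_gt0 ?subr_gt0.
have eta1 : eta < 1 by rewrite ltr_pdivrMr ?subr_gt0// mul1r ltrD2r.
pose E := [set w | (wasserstein nrm q (empirical (fun i => rB i w)) Pr
                    <= eps_B%:E)%E].
pose F := [set w | (wasserstein nrm q
  (empirical (fun j : 'I_T => r (t - j)%N w)) Pr <= eps_D%:E)%E].
have gE : g_sigma_preimage (fun i => rB i : Omega -> borel_vec R p) E.
  exact: wasserstein_event_g_sigma.
have gF : g_sigma_preimage
    (fun j : 'I_T => r (t - j)%N : Omega -> borel_vec R p) F.
  exact: wasserstein_event_g_sigma.
have g_sigma_measurable (k : nat) (X : 'I_k -> {RV P >-> borel_vec R p}) :
    g_sigma_preimage (fun i => X i : Omega -> borel_vec R p) `<=` measurable.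
  apply: smallest_sub; first exact: sigma_algebra_measurable.
  elim/big_ind : _ => [//|A B sA sB C [/sA|/sB]//|i _ _ [B mB <-]].
  exact: measurable_funP.
have PE : ((1 - beta)%:E <= P E)%E by exact: hconc.
have PF : ((1 - eta)%:E <= P F)%E by exact: hconc.
apply: (@le_trans _ _ (P (E `&` F))).
  rewrite hBD//; apply: le_trans (lee_pmul _ _ PE PF).
  - rewrite -EFinM lee_fin le_eqVlt; apply/orP; left; apply/eqP.
    by rewrite /eta; field; rewrite subr_eq0 gt_eqF.
  - by rewrite lee_fin subr_ge0 ltW.
  - by rewrite lee_fin subr_ge0 ltW.
apply: le_measure; rewrite ?inE.
- apply: measurableI; [exact: g_sigma_measurable gE|exact: g_sigma_measurable gF].
- exact: measurable_wasserstein_le.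
by move=> w [Ew Fw]; exact: wasserstein_triangle Ew Fw.
Qed.
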